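(* Let $\Gamma$ be a non-elementary hyperbolic group. For all $d,d_\ast\in\mathcal{D}_\Gamma$, we have $$\mathrm{Dil}_-=\alpha_{\min}\quad\text{and}\quad\mathrm{Dil}_+=\alpha_{\max},$$ where $$\mathrm{Dil}_-=\inf_{[x]\in\mathbf{conj}_{>0}}\frac{\ell_\ast[x]}{\ell[x]},\quad \mathrm{Dil}_+=\sup_{[x]\in\mathbf{conj}_{>0}}\frac{\ell_\ast[x]}{\ell[x]},\quad \alpha_{\min}=-\lim_{a\to\infty}\frac{\theta(a)}{a},\quad \alpha_{\max}=-\lim_{a\to-\infty}\frac{\theta(a)}{a}.$$
   Context: A metric $d$ on a set $X$ is hyperbolic if there is $\delta\ge 0$ such that $(x|y)_w\ge \min\{(x|z)_w,(z|y)_w\}-\delta$ for all $x,y,z,w\in X$, where $(x|y)_w=\frac12\big(d(w,x)+d(w,y)-d(x,y)\big)$. $\Gamma$ (identity $o$) is hyperbolic if some word metric (of a finite symmetric generating set) is hyperbolic, and non-elementary if moreover non-amenable. Two metrics $d,d'$ are quasi-isometric if there are $L>0,C\ge0$ with $L^{-1}d-C\le d'\le L d+C$. $\mathcal{D}_\Gamma$ is the set of left-invariant hyperbolic metrics on $\Gamma$ quasi-isometric to some (equivalently, every) word metric. The stable translation length for $d$ is $\ell[x]=\lim_{n\to\infty}\frac1nd(o,x^n)$, depending only on the conjugacy class $[x]$ of $x\in\Gamma$; $\ell_\ast$ is defined likewise from $d_\ast$. $\mathbf{conj}_{>0}$ is the set of conjugacy classes $[x]$ with $\ell[x]>0$ (equivalently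 $\ell_\ast[x]>0$). $\theta(a)$ is, for each $a\in\mathbb{R}$, the abscissa of convergence in $b$ of $\sum_{x\in\Gamma}\exp(-a\,d_\ast(o,x)-b\,d(o,x))$ (its graph is the Manhattan curve for $(d,d_\ast)$). *)

(* Defs.v *)
From HB Require Import structures.
From mathcomp Require Import all_boot all_order all_algebra.
From mathcomp Require Import all_classical all_reals all_analysis.

Set Implicit Arguments.
Unset Strict Implicit.
Unset Printing Implicit Defensive.

Import Order.TTheory GRing.Theory Num.Theory.
Import numFieldNormedType.Exports.

Local Open Scope classical_set_scope.
Local Open Scope ring_scope.

Section Metrics.
Context {R : realType} {X : Type}.
Implicit Types d : X -> X -> R.

Definition is_metric d : Prop :=
  [/\ forall x y, 0 <= d x y,
      forall x y, d x y = 0 <-> x = y,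
      forall x y, d x y = d y x
    & forall x y z, d x z <= d x y + d y z].

(* The Gromov product (x|y)_w. *)
Definition gromov_product d (x y w : X) : R :=
  2^-1 * (d w x + d w y - d x y).

Definition hyperbolic d : Prop :=
  exists2 delta : R, 0 <= delta &
    forall x y z w : X,
      Num.min (gromov_product d x z w) (gromov_product d z y w) - delta
        <= gromov_product d x y w.

Definition quasi_isometric d d' : Prop :=
  exists L C : R, [/\ 0 < L, 0 <= C &
    forall x y, L^-1 * d x y - C <= d' x y /\ d' x y <= L * d x y + C].

End Metrics.

Section Groups.
Context {R : realType} {G : groupType}.
Implicit Types (S : set G) (d ds : G -> G -> R).

Definition is_word_for S (x : G) (w : seq G) : Prop :=
  (forall s : G, s \in w -> S s) /\ (\prod_(s <- w) s)%g = x.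

(* As S is symmetric, words in S are products of elements of S and of their
   inverses, so the last condition says that S generates the group. *)
Definition finite_symmetric_generating S : Prop :=
  [/\ finite_set S, forall s : G, S s -> S s^-1%g
    & forall x : G, exists w, is_word_for S x w].

Definition word_length S (x : G) : R :=
  inf [set (size w)%:R | w in is_word_for S x].

Definition word_metric S (x y : G) : R := word_length S (x^-1 * y)%g.

Definition left_invariant d : Prop :=
  forall g x y : G, d (g * x)%g (g * y)%g = d x y.

(* The class D_Gamma. *)
Definition hyperbolic_metric_class : set (G -> G -> R) :=
  [set d | [/\ is_metric d, left_invariant d, hyperbolic d &
    exists2 S, finite_symmetric_generating S
             & quasi_isometric d (word_metric S)]].

Definition translation_length d (x : G) : R :=
  limn (fun n : nat => n%:R^-1 * d 1%g (x ^+ n)%g).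

Definition conj_class (x : G) : set G := range (fun g : G => (x ^ g)%g).

(* The translation length is constant on conjugacy classes, so it can be read
   off at the representative of c chosen by xget (1 is only returned for
   c = set0, which is not a conjugacy class). *)
Definition class_translation_length d (c : set G) : R :=
  translation_length d (xget 1%g c).

Definition conj_pos d : set (set G) :=
  [set c | range conj_class c /\ 0 < class_translation_length d c].

Definition class_ratio d ds (c : set G) : R :=
  class_translation_length ds c / class_translation_length d c.

Definition Dil_minus d ds : \bar R :=
  ereal_inf [set (class_ratio d ds c)%:E | c in conj_pos d].

Definition Dil_plus d ds : \bar R :=
  ereal_sup [set (class_ratio d ds c)%:E | c in conj_pos d].

(* The abscissa of convergence in b, a priori an extended real. *)
Definition theta d ds (a : R) : \bar R :=
  ereal_inf [set b%:E | b in [set b : R |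
    (\esum_(x in [set: G]) (expR (- a * ds 1%g x - b * d 1%g x))%:E
       < +oo)%E]].

Definition theta_slope d ds (a : R) : \bar R :=
  (theta d ds a * (a^-1)%:E)%E.

Definition alpha_min d ds : \bar R :=
  (- lim (theta_slope d ds a @[a --> +oo%R]))%E.

Definition alpha_max d ds : \bar R :=
  (- lim (theta_slope d ds a @[a --> -oo%R]))%E.

End Groups.

(* Amenability of a discrete group: existence of a left-invariant, finitely
   additive probability measure defined on all subsets. *)
Definition amenable (R : realType) (G : groupType) : Prop :=
  exists mu : set G -> R,
    [/\ mu setT = 1,
        forall A : set G, 0 <= mu A,
        forall A B : set G, A `&` B = set0 -> mu (A `|` B) = mu A + mu B
      & forall (g : G) (A : set G), mu [set (g * x)%g | x in A] = mu A].

Definition hyperbolic_group (R : realType) (G : groupType) : Prop :=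
  exists2 S : set G, finite_symmetric_generating S
                   & hyperbolic (word_metric S : G -> G -> R).

Definition non_elementary_hyperbolic (R : realType) (G : groupType) : Prop :=
  hyperbolic_group R G /\ ~ amenable R G.

(* Main.v *)
Require Import Defs.
From mathcomp Require Import all_boot all_order all_algebra.
From mathcomp Require Import all_classical all_reals all_analysis.
From mathcomp Require Import zify lra ring.

Set Implicit Arguments.
Unset Strict Implicit.
Unset Printing Implicit Defensive.

Import Order.TTheory GRing.Theory Num.Theory.
Import numFieldNormedType.Exports.

Local Open Scope classical_set_scope.
Local Open Scope ring_scope.

(* A left-invariant hyperbolic metric satisfies the four-point inequality, which
   gives l[g] >= |g^2| - |g| - 2 delta, where |x| = d(1, x).  If the points y and
   s y, for some generator s depending on y, have Gromov product at most a fixed K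
   seen from 1, then every x is at bounded distance from some g with
   l[g] >= |x| - C.  As l_* <= |.|_* always, this applied to d yields
   |x|_* >= Dil_- |x| - C', and applied to d_* it yields |x|_* <= Dil_+ |x| + C'.
   Then theta(a) + a Dil stays between 0 and the growth exponent of d, the lower
   bound coming from the powers of a single x, and the slopes follow.

   If no such K exists, the group almost fixes points arbitrarily far away.  The
   tubes around geodesics issued from 1 towards such a point then form increasing
   chains of sets, nearly invariant under generators and of subexponential size,
   hence contain Folner sets, and the group is amenable.  The four-point
   inequality on a word path gives midpoints with logarithmic error; that crude
   substitute for the Morse lemma is enough here. *)

(** * Subadditive sequences and stable translation lengths *)

Section Subadditive.
Context {R : realType} (u : nat -> R).
Hypotheses (u0 : u 0%N = 0) (u_ge0 : forall n, 0 <= u n).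
Hypothesis uD : forall m n, u (m + n)%N <= u m + u n.

Lemma subadditive_mul q n : u (q * n)%N <= q%:R * u n.
Proof.
elim: q => [|q IH]; first by rewrite mul0n u0 mul0r.
by rewrite mulSn (le_trans (uD _ _))// -natr1; lra.
Qed.

(** Fekete's lemma: the limit is the infimum of [u n / n] over positive [n], and Euclidean division
    by an almost optimal [N.+1] gives the upper bound. *)
Lemma subadditive_cvg : exists L : R,
  [/\ (fun n => n%:R^-1 * u n) @ \oo --> L, 0 <= L & forall n, n%:R * L <= u n].
Proof.
pose A := [set n.+1%:R^-1 * u n.+1 | n in [set: nat]].
have A0 : A !=set0 by exists (1%:R^-1 * u 1%N), 0%N.
have Age0 : lbound A 0 by move=> _ [n _ <-]; rewrite mulr_ge0 ?invr_ge0 ?ler0n.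
have Ainf : has_inf A by split => //; exists 0.
have Ale n : (0 < n)%N -> inf A <= n%:R^-1 * u n.
  by case: n => // n _; apply: ge_inf; [exists 0 | exists n].
exists (inf A); split; last 2 first.
- exact: lb_le_inf.
- case=> [|n]; first by rewrite mul0r u0.
  by rewrite mulrC -ler_pdivlMr ?ltr0n// mulrC Ale.
apply/cvgrPdist_le => eps eps0.
have [_ [N _ <-] Nlt] := inf_adherent (divr_gt0 eps0 (ltr0n R 2)) Ainf.
(* This bounds [u] at every remainder modulo [N.+1]. *)
set M : R := N.+1%:R * u 1%N.
have M0 : 0 <= M by rewrite mulr_ge0.
near=> n.
have n0 : (0 < n)%N by near: n; exists 1%N.
have n0R : (0 : R) < n%:R by rewrite ltr0n.
have nM : M / (eps / 2) <= n%:R.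
  near: n; exists (Num.trunc (M / (eps / 2))).+1 => // n /= hn.
  by rewrite (le_trans (ltW (truncnS_gt _)))// ler_nat.
have nM' : M <= (eps / 2) * n%:R by rewrite mulrC -ler_pdivrMr// divr_gt0.
have h1 := Ale _ n0.
rewrite distrC ger0_norm ?subr_ge0// lerBlDr.
have nE : n%:R = (n %/ N.+1)%:R * N.+1%:R + (n %% N.+1)%:R :> R.
  by rewrite [in LHS](divn_eq n N.+1) natrD natrM.
have h2 : u n <= (n %/ N.+1)%:R * u N.+1 + M.
  rewrite [in u n](divn_eq n N.+1) (le_trans (uD _ _))// lerD ?subadditive_mul//.
  rewrite -[X in u X]muln1 (le_trans (subadditive_mul _ _))// ler_wpM2r//.
  by rewrite ler_nat ltnW// ltn_mod.
have h3 : u N.+1 <= N.+1%:R * (inf A + eps / 2).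
  by rewrite mulrC -ler_pdivrMr ?ltr0n// mulrC ltW.
have hI : 0 <= inf A + eps / 2 by rewrite (le_trans _ (ltW Nlt))// mulr_ge0.
rewrite mulrC ler_pdivrMr// (le_trans h2)//.
have h4 : (n %/ N.+1)%:R * u N.+1 <= n%:R * (inf A + eps / 2).
  rewrite nE mulrDl -mulrA -[X in X <= _]addr0 lerD ?mulr_ge0//.
  by rewrite ler_wpM2l.
by rewrite (le_trans (lerD h4 nM'))//; lra.
Unshelve. all: by end_near. Qed.

End Subadditive.

Section TranslationLength.
Context {R : realType} {G : groupType} (d : G -> G -> R).
Hypotheses (dM : is_metric d) (dL : left_invariant d).
Local Notation len x := (d 1%g x).
Local Notation tlen := (translation_length d).

Lemma is_metric_ge0 x y : 0 <= d x y. Proof. by case: dM. Qed.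
Lemma is_metric_xx x : d x x = 0. Proof. by case: dM => _ + _ _ => ->. Qed.
Lemma is_metricC x y : d x y = d y x. Proof. by case: dM. Qed.
Lemma is_metric_triangle y x z : d x z <= d x y + d y z. Proof. by case: dM. Qed.

Lemma dist_len x y : d x y = len (x^-1 * y)%g.
Proof. by rewrite -(dL x^-1%g x y) mulVg. Qed.

Lemma lenV x : len x^-1%g = len x.
Proof. by rewrite -(dL x 1%g) mulgV mulg1 is_metricC. Qed.

Lemma lenM x y : len (x * y)%g <= len x + len y.
Proof. by rewrite (le_trans (is_metric_triangle x _ _))// -{2}[x]mulg1 dL. Qed.

Lemma translation_length_cvg x :
  [/\ (fun n : nat => n%:R^-1 * len (x ^+ n)%g) @ \oo --> tlen x, 0 <= tlen x
    & forall n, n%:R * tlen x <= len (x ^+ n)%g].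
Proof.
have [|n|m n|L [cL L0 Lle]] := @subadditive_cvg R (fun n => len (x ^+ n)%g).
- exact: is_metric_xx.
- exact: is_metric_ge0.
- by rewrite expgnDr lenM.
- by have -> : tlen x = L by exact/cvg_lim.
Qed.

Lemma translation_length_ge0 x : 0 <= tlen x.
Proof. by have [] := translation_length_cvg x. Qed.

Lemma translation_length_le x : tlen x <= len x.
Proof.
by have [_ _ /(_ 1%N)] := translation_length_cvg x; rewrite mul1r expg1.
Qed.

(** Dividing by [n] and passing to the limit removes [B]. Conjugacy invariance, the estimate by the
    square and the comparison of two metrics all rest on this. *)
Lemma translation_length_lb x c A B :
  (forall n, n%:R * c <= A * len (x ^+ n)%g + B) -> c <= A * tlen x.
Proof.
move=> h; have [cv _ _] := translation_length_cvg x.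
have cvh : (fun n : nat => A * (n%:R^-1 * len (x ^+ n)%g) + n%:R^-1 * B) @ \oo
    --> A * tlen x + 0 * B.
  apply: cvgD (cvgM (cvg_cst A) cv) (cvgM _ (cvg_cst B)).
  by apply/gtr0_cvgV0; [exists 1%N => // n /=; rewrite ltr0n|exact: cvgr_idn].
rewrite -[leRHS]addr0 -[X in _ + X](mul0r B); apply: (cvgr_to_ge cvh); near=> n.
have n0 : (0 : R) < n%:R by rewrite ltr0n; near: n; exists 1%N.
rewrite mulrCA -mulrDr mulrC ler_pdivlMr// mulrC; exact: h.
Unshelve. all: by end_near. Qed.

Lemma translation_length_conj x g : tlen (x ^ g)%g = tlen x.
Proof.
suff le_conj y h : tlen y <= tlen (y ^ h)%g.
  by apply/eqP; rewrite eq_le le_conj -{2}(conjgK g x) le_conj.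
rewrite -[leRHS]mul1r; apply: (@translation_length_lb _ _ _ (2 * len h)) => n.
have [_ _ /(_ n) /le_trans->//] := translation_length_cvg y.
rewrite -{1}(conjgK h (y ^+ n)%g) conjXg conjgE invgK mul1r.
have := lenM h ((y ^ h) ^+ n * h^-1)%g; have := lenM ((y ^ h) ^+ n)%g h^-1%g.
by rewrite lenV; lra.
Qed.

End TranslationLength.

(** * The four-point inequality *)

Lemma seq_bounded {R : realDomainType} {T : eqType} (s : seq T) (f : T -> R) :
  exists2 c : R, 0 <= c & forall x, x \in s -> f x <= c.
Proof.
elim: s => [|a s [c c0 cs]]; first by exists 0.
exists (Num.max c (f a)); first by rewrite le_max c0.
move=> x; rewrite inE le_max => /predU1P[->|/cs ->//].
by rewrite lexx orbT.
Qed.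

Section FourPoint.
Context {R : realType} {G : groupType} (d : G -> G -> R) (e : R).
Hypotheses (dM : is_metric d) (dL : left_invariant d).
Hypothesis dH : forall x y z w,
  Num.min (gromov_product d x z w) (gromov_product d z y w) - e
    <= gromov_product d x y w.
Local Notation len x := (d 1%g x).
Local Notation tlen := (translation_length d).
Local Notation gp := (gromov_product d).

Lemma gp_split x y z w : gp x y w - e <= gp x z w \/ gp y z w - e <= gp x z w.
Proof.
have := dH x z y w; rewrite lerBlDr ge_min.
by case/orP => h; [left|right]; rewrite lerBlDr.
Qed.

(** Hyperbolicity without a base point: of the three sums over pairings of four points, none exceeds
    the larger of the other two by more than [2 * e]. *)
Lemma four_point x y z w : d x z + d y w <= d x y + d z w + 2 * e \/
  d x z + d y w <= d y z + d x w + 2 * e.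
Proof.
rewrite (is_metricC dM z w) (is_metricC dM y w) (is_metricC dM x w).
have [] := gp_split x y z w; rewrite /gromov_product.
  by left; lra.
by right; lra.
Qed.

Lemma gp_ge0 x y w : 0 <= gp x y w.
Proof.
have := is_metric_triangle dM w x y.
by rewrite /gromov_product (is_metricC dM x w); lra.
Qed.

Lemma gp_le_dist x y w : gp x y w <= d w x.
Proof. by have := is_metric_triangle dM x w y; rewrite /gromov_product; lra. Qed.

Lemma gpC x y w : gp x y w = gp y x w.
Proof. by rewrite /gromov_product (is_metricC dM x y); lra. Qed.

Lemma gp_left g x y w : gp (g * x)%g (g * y)%g (g * w)%g = gp x y w.
Proof. by rewrite /gromov_product !dL. Qed.

Lemma gp_lipschitz_arg x x' y w : gp x y w <= gp x' y w + d x x'.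
Proof.
have := is_metric_triangle dM x' w x; have := is_metric_triangle dM x x' y.
by rewrite /gromov_product (is_metricC dM x' x); lra.
Qed.

Lemma gp_lipschitz_base x y w w' : gp x y w <= gp x y w' + d w w'.
Proof.
have := is_metric_triangle dM w' w x; have := is_metric_triangle dM w' w y.
by rewrite /gromov_product; lra.
Qed.

(** If the left-hand side [c] is positive, each power of [g] is longer than the previous one by at
    least [c]: among [1] and three successive powers, the other alternative of [four_point] would
    contradict the preceding increase. *)
Lemma translation_length_square g : len (g ^+ 2)%g - len g - 2 * e <= tlen g.
Proof.
set c := _ - _ - _; have [c0|c0] := leP c 0.
  by rewrite (le_trans c0)// translation_length_ge0.
rewrite -[leRHS]mul1r; apply: (@translation_length_lb _ _ _ dM dL _ _ _ 0) => n.
rewrite mul1r addr0.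
have step m : len (g ^+ m)%g + c <= len (g ^+ m.+1)%g.
  elim: m => [|m IH].
    rewrite expg0 expg1 is_metric_xx// add0r /c.
    have := lenM dM dL g g; rewrite expg2.
    (* This instance serves to give [0 <= e]. *)
    have := gp_split 1%g g 1%g 1%g; rewrite /gromov_product.
    by rewrite !is_metric_xx// (is_metricC dM g 1%g); lra.
  have dS k : d (g ^+ k)%g (g ^+ k.+1)%g = len g.
    by rewrite expgSr dist_len// mulKg.
  have d2 : d (g ^+ m)%g (g ^+ m.+2)%g = len (g ^+ 2)%g.
    by rewrite -[m.+2]addn2 expgnDr dist_len// mulKg.
  have := four_point 1%g (g ^+ m)%g (g ^+ m.+1)%g (g ^+ m.+2)%g.
  by rewrite !dS d2; move: IH c0; rewrite /c; lra.
elim: n => [|n IH]; first by rewrite mul0r is_metric_ge0.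
by rewrite -[n.+1%:R]natr1; have := step n; lra.
Qed.

(* Replacing [x] by [x h^-1] with [h] in [1 :: F] moves the direction of the
   inverse to [h x^-1] but hardly that of [x]; as the points [x^-1] and
   [f x^-1] point away from each other, one of them points away from [x]. *)
Lemma nearby_translation_length (F : seq G) (K : R) :
    (forall y, exists2 f, f \in F & gp y (f * y)%g 1%g <= K) ->
  exists C : R, forall x, exists2 g, d x g <= C & len x - C <= tlen g.
Proof.
move=> FK; have [c c0 Fc] := seq_bounded F (fun f => len f).
have K0 : 0 <= K by have [f _] := FK 1%g; apply: le_trans; exact: gp_ge0.
have e0 : 0 <= e.
  have := gp_split 1%g 1%g 1%g 1%g.
  by rewrite /gromov_product !is_metric_xx//; lra.
exists (2 * (K + e + c) + 2 * e + c) => x.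
have [h hc hx] : exists2 h, len h <= c & gp (h * x^-1)%g x 1%g <= K + e.
  have [f /Fc fc fK] := FK x^-1%g.
  have := gp_split x^-1%g x (f * x^-1)%g 1%g.
  have [xx|xx] := leP (gp x^-1%g x 1%g) (K + e).
    by exists 1%g; rewrite ?is_metric_xx// mul1g.
  move=> [|] hyp; first by exfalso; lra.
  by exists f => //; rewrite gpC; lra.
have dh' : d x (x * h^-1)%g <= c by rewrite dist_len// mulKg lenV.
exists (x * h^-1)%g; first by lra.
have := translation_length_square (x * h^-1)%g.
(* With [g = x * h^-1], this distance is [2 * len g] minus twice the Gromov product of [g^-1] and
   [g] seen from [1]. *)
have -> : len ((x * h^-1) ^+ 2)%g = d (h * x^-1)%g (x * h^-1)%g.
  by rewrite (dist_len dL (h * x^-1)%g) invgM invgK expg2.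
have lip : gp (h * x^-1)%g (x * h^-1)%g 1%g <= K + e + c.
  rewrite gpC (le_trans (gp_lipschitz_arg _ x _ _))// lerD 1?gpC//.
  by rewrite (is_metricC dM).
have hxV : len (h * x^-1)%g = len (x * h^-1)%g by rewrite -lenV// invgM invgK.
have := is_metric_triangle dM (x * h^-1)%g 1%g x.
rewrite (is_metricC dM (x * h^-1)%g x).
by move: lip; rewrite /gromov_product hxV; lra.
Qed.

End FourPoint.

(** * Rough midpoints *)

Lemma sqr_le_expn k : (k * k <= 4 * 2 ^ k)%N.
Proof.
elim: k => // k IH; have := ltn_expl k (leqnn 2).
by rewrite expnS; nia.
Qed.

Lemma log2_sublinear {R : realType} (a b e c eps : R) :
    0 <= a -> 0 <= b -> 0 < eps ->
  exists2 N : R, 1 <= N & forall t, N <= t ->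
    exists k : nat, a * t + b <= 2 ^+ k /\ e * k%:R + c <= eps * t.
Proof.
move=> a0 b0 eps0; pose B := a + b + 1; pose al := eps / (32 * B).
have B1 : 1 <= B by rewrite /B; lra.
have al0 : 0 < al by rewrite divr_gt0//; lra.
pose N0 := (e ^+ 2 / (4 * al) + c) * 2 / eps.
exists (Num.max 1 N0); first by rewrite le_max lexx.
move=> t; rewrite ge_max => /andP[t1 tN0].
pose n := (Num.trunc (B * t)).+1; pose m := trunc_log 2 n; exists m.+1.
have Bt1 : 1 <= B * t by nra.
have nlt : B * t < n%:R by rewrite truncnS_gt.
have nle : n%:R <= 2 * (B * t).
  rewrite -[X in X <= _]natr1.
  have : (Num.trunc (B * t))%:R <= B * t by rewrite truncn_le//; lra.
  lra.
have mlt : (n < 2 ^ m.+1)%N by rewrite trunc_log_ltn.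
have mle : (2 ^ m <= n)%N by rewrite trunc_logP.
have mltR : n%:R < 2 ^+ m.+1 :> R by rewrite -natrX ltr_nat.
have mleR : 2 ^+ m <= n%:R :> R by rewrite -natrX ler_nat.
split.
  by rewrite (le_trans _ (ltW mltR))// (le_trans _ (ltW nlt))// /B; nra.
have : (m.+1 * m.+1)%:R <= (4 * 2 ^ m.+1)%:R :> R by rewrite ler_nat sqr_le_expn.
rewrite !natrM natrX exprS; set k : R := m.+1%:R => hk.
have hk' : k * k <= 16 * (B * t) by lra.
(* Completing the square trades [e * k] for [al * (k * k)] plus a constant; [al] is such that
   [al * (16 * (B * t))] equals [eps * t / 2]. *)
have sq : 0 <= al * (k - e / (2 * al)) ^+ 2 by rewrite mulr_ge0 ?sqr_ge0// ltW.
have sqE : al * (k - e / (2 * al)) ^+ 2 =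
    al * (k * k) - e * k + e ^+ 2 / (4 * al).
  by field; rewrite gt_eqF.
have h1 : al * (k * k) <= eps * t / 2.
  rewrite (le_trans (ler_wpM2l (ltW al0) hk'))// /al.
  rewrite le_eqVlt; apply/orP; left; apply/eqP; field.
  by rewrite gt_eqF//; lra.
have h2 : e ^+ 2 / (4 * al) + c <= eps * t / 2.
  by move: tN0; rewrite /N0 ler_pdivrMr//; lra.
by move: sq; rewrite sqE; lra.
Qed.

Section Paths.
Context {R : realType} {G : groupType} (d : G -> G -> R) (e : R).
Hypotheses (dM : is_metric d) (dL : left_invariant d).
Hypothesis dH : forall x y z w,
  Num.min (gromov_product d x z w) (gromov_product d z y w) - e
    <= gromov_product d x y w.
Local Notation len x := (d 1%g x).
Local Notation gp := (gromov_product d).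

(* [u] plays the part of the distance to a point that need not belong to [G]. *)
Lemma path_near (u : G -> R) (z : nat -> G) (c : R) :
    (forall x y z, u y + d x z <= d x y + u z + 2 * e \/
       u y + d x z <= d y z + u x + 2 * e) ->
    (forall i, d (z i) (z i.+1) <= c) ->
  forall k i m, (m <= 2 ^ k)%N -> exists j,
    u (z j) <= (u (z i) + u (z (i + m)%N) - d (z i) (z (i + m)%N)) / 2
               + e * k%:R + c.
Proof.
move=> uH zc; have c0 : 0 <= c by rewrite (le_trans _ (zc 0%N))// is_metric_ge0.
elim=> [|k IH] i m.
  case: m => [|[|//]] _; first by exists i; rewrite addn0 is_metric_xx//; lra.
  rewrite addn1; have := zc i; have [h|h] := leP (u (z i)) (u (z i.+1)).
    by exists i; lra.
  by exists i.+1; lra.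
move=> mk; have [|j1 h1] := IH i (m./2).
  by move: mk; rewrite expnS; have := odd_double_half m; lia.
have [|j2 h2] := IH (i + m./2)%N (m - m./2)%N.
  by move: mk; rewrite expnS; have := odd_double_half m; lia.
have mE : (i + m./2 + (m - m./2) = i + m)%N by have := odd_double_half m; lia.
rewrite mE in h2.
(* Half of [u p + u q - d p q] behaves like a Gromov product: for one of the two half paths it
   exceeds that of the whole path by at most [e]. *)
have := uH (z i) (z (i + m./2)%N) (z (i + m)%N).
by rewrite -[k.+1%:R]natr1 => -[h3|h3]; [exists j1|exists j2]; lra.
Qed.

Context (S : seq G) (L C : R).
Hypothesis (L0 : 0 <= L) (C0 : 0 <= C).
Hypothesis words : forall x, exists w,
  [/\ {subset w <= S}, (\prod_(s <- w) s)%g = x & (size w)%:R <= L * len x + C].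

(** Bisecting a word for [y] costs [e] per level and reaches single letters after [k] levels, since
    the word has at most [2 ^+ k] letters. *)
Lemma rough_midpoint_log : exists c : R, forall y k (D : R),
  L * len y + C <= 2 ^+ k -> 0 <= D <= len y ->
  exists p, len p <= D + (e * k%:R + c) /\ d p y <= len y - D + (e * k%:R + c).
Proof.
have [c c0 cS] := seq_bounded S (fun s => len s).
exists c => y k D yk /andP[D0 Dy].
have [w [wS wy wsz]] := words y.
pose z i := (\prod_(s <- take i w) s)%g.
have zc i : d (z i) (z i.+1) <= c.
  have [iw|iw] := ltnP i (size w).
    rewrite /z (take_nth 1%g)// big_rcons/= dist_len// mulKg.
    by apply/cS/wS/mem_nth.
  by rewrite /z !take_oversize ?is_metric_xx// (leq_trans iw).
have z0 : z 0%N = 1%g by rewrite /z take0 big_nil.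
have zw : z (size w) = y by rewrite /z take_size.
(* For a point at distance [D] from [1] on a geodesic to [y], hyperbolicity makes
   [u p] the distance to [p] up to a constant; being a maximum of translates of
   distance functions, [u] inherits the four-point inequality. *)
pose u p : R := Num.max (len p - D) (d y p - (len y - D)).
have uH p q r : u q + d p r <= d p q + u r + 2 * e \/
    u q + d p r <= d q r + u p + 2 * e.
  have mx a b : a <= Num.max a b /\ b <= Num.max a b :> R.
    by rewrite !le_max !lexx orbT.
  have [p1 p2] := mx (len p - D) (d y p - (len y - D)).
  have [r1 r2] := mx (len r - D) (d y r - (len y - D)).
  rewrite -/(u p) -/(u r) in p1 p2 r1 r2.
  have uq : u q = len q - D \/ u q = d y q - (len y - D).
    by rewrite /u; case: leP => _; [right|left].
  case: uq => ->.
    have := four_point dM dH p q r 1%g.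
    rewrite (is_metricC dM q 1%g) (is_metricC dM r 1%g) (is_metricC dM p 1%g).
    by case=> h; [left|right]; lra.
  have := four_point dM dH p q r y.
  rewrite (is_metricC dM q y) (is_metricC dM r y) (is_metricC dM p y).
  by case=> h; [left|right]; lra.
have [|j] := @path_near u z c uH zc k 0%N (size w).
  by rewrite -(ler_nat R) natrX (le_trans wsz).
rewrite add0n z0 zw.
(* The values of [u] at the two ends add up to [len y], so the main term in [path_near] vanishes. *)
have -> : u 1%g = D.
  by rewrite /u is_metric_xx// (is_metricC dM y); case: leP; lra.
have -> : u y = len y - D by rewrite /u !is_metric_xx//; case: leP; lra.
move=> uj; exists (z j); rewrite (is_metricC dM _ y).
by move: uj; rewrite /u ge_max => /andP[? ?]; split; lra.
Qed.

Lemma rough_midpoint (eps : R) : 0 < eps -> exists2 N : R, 1 <= N &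
  forall y (D : R), N <= len y -> 0 <= D <= len y -> exists p,
    len p <= D + eps * len y /\ d p y <= len y - D + eps * len y.
Proof.
move=> eps0; have [c mid] := rough_midpoint_log.
have [N N1 hN] := log2_sublinear e c L0 C0 eps0; exists N => // y D Ny Dy.
have [k [k1 k2]] := hN _ Ny; have [p [p1 p2]] := mid y k D k1 Dy.
by exists p; split; lra.
Qed.

(* Repeated halving towards [1]: each step costs [e] in the Gromov product with
   [y], which is absorbed because [len p] has shrunk by a fixed factor. *)
Lemma rough_truncation : exists2 N0 : R, 1 <= N0 &
  forall (N : R) y, N0 <= N -> N <= len y ->
  exists p, [/\ N <= len p, len p <= 3 * N & len p / 4 <= gp p y 1%g].
Proof.
have [|N1 N11 mid] := @rough_midpoint (16^-1); first lra.
pose N0 := Num.max N1 (Num.max (64 * e) 0); exists N0.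
  by rewrite le_max N11.
move=> N y; rewrite !ge_max => /andP[NN1 /andP[Ne _]] Ny.
(* The number [n] merely bounds the halvings: each removes at least 7/16 of a length exceeding
   [3 * N], hence more than 1. *)
suff aux n : forall p, len p <= 3 * N + n%:R -> N <= len p ->
    len p / 4 <= gp p y 1%g ->
    exists p, [/\ N <= len p, len p <= 3 * N & len p / 4 <= gp p y 1%g].
  apply: (aux (Num.trunc (len y)).+1 y) => //.
    by have := truncnS_gt (len y); lra.
  by rewrite /gromov_product is_metric_xx//; have := is_metric_ge0 dM 1%g y; lra.
elim: n => [|n IH] p; first by rewrite addr0 => *; exists p.
rewrite -[n.+1%:R]natr1 => pn Np gpp.
have [pN|pN] := leP (len p) (3 * N); first by exists p.
have [||q [q1 q2]] := mid p (len p / 2); [lra|lra|].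
have tri := is_metric_triangle dM q 1%g p.
have gpq : 7 / 16 * len p <= gp q p 1%g by rewrite /gromov_product; lra.
apply: (IH q); [lra|lra|].
by have [h|h] := gp_split dH q p y 1%g; lra.
Qed.

End Paths.

(** * Amenability from Folner sets *)

Lemma ultra_fmap {T U : Type} (f : T -> U) (F : set_system T) :
  UltraFilter F -> UltraFilter (f @ F).
Proof.
move=> FU; split; first exact: fmap_proper_filter.
move=> G GF fFG; rewrite predeqE => A; split; last exact: fFG.
move=> GA; have [//|FnA] := in_ultra_setVsetC (f @^-1` A) FU.
have : G (~` A) by exact: fFG.
by move=> /(filterI GA); rewrite setICr => /filter_not_empty.
Qed.

Section Folner.
Context {R : realType} {G : groupType} (S : seq G).
Hypothesis Sgen : forall x, exists w, {subset w <= S} /\ (\prod_(s <- w) s)%g = x.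
Hypothesis SV : forall s, s \in S -> s^-1%g \in S.

(** The mean of [B] is the limit, along an ultrafilter, of the proportion of [B] in better and
    better Folner sets; it exists because [[0, 1]] is compact. *)
Lemma folner_amenable :
    (forall eta : R, 0 < eta -> exists A : seq G, [/\ uniq A, A != [::] &
       forall s, s \in S ->
         (count (fun p => (s * p)%g \notin A) A)%:R <= eta * (size A)%:R]) ->
  amenable R G.
Proof.
move=> folner.
have /choice[A AP] : forall n, exists A : seq G, [/\ uniq A, A != [::] &
    forall s, s \in S -> (count (fun p => (s * p)%g \notin A) A)%:R <=
      harmonic n * (size A)%:R :> R].
  by move=> n; exact/folner/harmonic_gt0.
have sz0 n : 0 < (size (A n))%:R :> R.
  by have [_ + _] := AP n; rewrite ltr0n; case: (A n).
pose dens (B : set G) n : R :=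
  (count (fun p => p \in B) (A n))%:R / (size (A n))%:R.
(* As [U] refines the eventual filter, ordinary limits such as that of [harmonic] persist along
   it. *)
have [U [UU UN]] := ultraFilterLemma (@eventually_filter).
have dens01 B n : 0 <= dens B n <= 1.
  rewrite /dens divr_ge0 ?ler0n//= ler_pdivrMr// mul1r ler_nat.
  exact: count_size.
have /choice[mu muP] : forall B, exists l : R, dens B @ U --> l.
  move=> B; have := @segment_compact R 0 1.
  rewrite compact_ultra => /(_ _ (ultra_fmap (dens B) UU))[|l [_ Bl]].
    suff : U (dens B @^-1` `[0, 1]) by [].
    by apply: filterS filterT => n _ /=; rewrite in_itv/= dens01.
  by exists l.
have muU B l : dens B @ U --> l -> mu B = l.
  by move=> h; apply: (cvg_unique _ (muP B) h); exact: Rhausdorff.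
have mu_ge0 B : 0 <= mu B.
  apply: cvgr_to_ge (muP B) _; apply: filterS filterT => n _.
  by case/andP: (dens01 B n).
have muS (s : G) B : s \in S -> mu [set (s * x)%g | x in B] <= mu B.
  move=> sS; have hU : dens B \+ harmonic @ U --> mu B + 0.
    by apply: cvgD (muP B) _; apply: cvg_trans cvg_harmonic; exact: cvg_app.
  rewrite -[leRHS]addr0; apply: ler_cvg_to (muP _) hU _.
  apply: filterS filterT => n _ /=; have [Au A0 /(_ _ (SV sS)) As] := AP n.
  rewrite /dens ler_pdivrMr// mulrDl divfK ?gt_eqF//.
  rewrite (le_trans _ (lerD (lexx _) As))// -natrD ler_nat.
  (* The points of [A n] in the translate of [B] are split in two: those that [s^-1] keeps in [A n]
     inject into [B] within [A n], and the others are few. *)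
  pose a := [pred p | p \in [set (s * x)%g | x in B]].
  pose P := [pred p | (s^-1 * p)%g \in A n].
  rewrite (@leq_trans (count (predU (predI a P) (predC P)) (A n)))//.
    by apply: sub_count => p /= ->/=; exact: orbN.
  rewrite (leq_trans (leq_addr (count (predI (predI a P) (predC P)) (A n)) _))//.
  rewrite count_predUI leq_add2r -!size_filter.
  rewrite -(size_map (fun p => (s^-1 * p)%g)); apply: uniq_leq_size.
    by rewrite map_inj_uniq ?filter_uniq//; exact: mulgI.
  move=> _ /mapP[p + ->]; rewrite !mem_filter/= -andbA.
  by case/and3P=> /set_mem[x Bx <-] + _; rewrite mulKg => ->; rewrite mem_set.
have mu_gen (w : seq G) B : {subset w <= S} ->
    mu [set ((\prod_(s <- w) s) * x)%g | x in B] <= mu B.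
  elim: w B => [|s w IH] B wS.
    rewrite big_nil; under eq_imagel do rewrite mul1g.
    by rewrite image_id.
  rewrite big_cons; have -> : [set (s * \prod_(j <- w) j * x)%g | x in B] =
      [set (s * x)%g | x in [set ((\prod_(j <- w) j) * x)%g | x in B]].
    by rewrite image_comp; apply: eq_imagel => x _ /=; rewrite mulgA.
  rewrite (le_trans (muS _ _ _))//; first by rewrite wS ?mem_head.
  by apply: IH => x xw; rewrite wS// inE xw orbT.
have mu_le (g : G) B : mu [set (g * x)%g | x in B] <= mu B.
  by have [w [wS <-]] := Sgen g; exact: mu_gen.
exists mu; split => //.
- apply: muU; rewrite (_ : dens _ = cst 1); first exact: cvg_cst.
  apply/funext => n; rewrite /dens (eq_count (a2 := predT)) ?count_predT.
    by rewrite divff// gt_eqF.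
  by move=> x; rewrite in_setT.
- move=> B B' BB'; apply: muU.
  rewrite (_ : dens _ = dens B \+ dens B'); first exact: cvgD.
  apply/funext => n; rewrite /dens/= -mulrDl -natrD -count_predUI.
  rewrite [X in (_ + X)%N](eq_count (a2 := pred0)) ?count_pred0 ?addn0.
    by congr (_%:R / _); apply: eq_count => x /=; rewrite in_setU.
  move=> x /=; rewrite -in_setI BB'; apply/negbTE/negP; rewrite in_setE//.
(* The reverse inequality is [mu_le] for [g^-1] and the translate of [B]. *)
- move=> g B; apply/eqP; rewrite eq_le mu_le/=.
  have {1}-> : B = [set (g^-1 * x)%g | x in [set (g * x)%g | x in B]].
    rewrite image_comp -[LHS]image_id; apply: eq_imagel => x _ /=.
    by rewrite mulKg.
  exact: mu_le.
Qed.

End Folner.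

(** * Words, and Folner sets in slowly growing chains *)

Section Words.
Context {G : groupType} (S : seq G).

(** Repetitions are kept, so that the size is exactly a power of [size S]. *)
Fixpoint words_of_length k : seq G :=
  if k is k'.+1 then [seq (s * w)%g | s <- S, w <- words_of_length k']
  else [:: 1%g].

Lemma size_words_of_length k : size (words_of_length k) = (size S ^ k)%N.
Proof. by elim: k => //= k IH; rewrite size_allpairs IH expnS. Qed.

Lemma words_of_lengthS s w k :
  s \in S -> w \in words_of_length k -> (s * w)%g \in words_of_length k.+1.
Proof. by move=> sS wk; apply/allpairsP; exists (s, w). Qed.

Lemma words_of_lengthP s k : s \in words_of_length k.+1 ->
  exists a w, [/\ a \in S, w \in words_of_length k & s = (a * w)%g].
Proof. by case/allpairsP=> -[a w] [aS wk ->]; exists a, w. Qed.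

Hypothesis S1 : 1%g \in S.

Lemma words_of_length_sub k m w :
  (k <= m)%N -> w \in words_of_length k -> w \in words_of_length m.
Proof.
move=> /subnKC <-; elim: (m - k)%N => [|n IH] wk; first by rewrite addn0.
by rewrite addnS -[w]mul1g words_of_lengthS// IH.
Qed.

Lemma prod_words_of_length w :
  {subset w <= S} -> (\prod_(s <- w) s)%g \in words_of_length (size w).
Proof.
elim: w => [|a w IH] wS; first by rewrite big_nil inE.
rewrite big_cons words_of_lengthS ?wS ?mem_head// IH// => x xw.
by rewrite wS// inE xw orbT.
Qed.

End Words.

(** Some step must grow by a factor at most [1 + eta], or [F M] would be too large. At such a step,
    the translates by [s] that leave [F k] are disjoint from it and still in [F k.+1], hence few. *)
Lemma chain_folner {R : realType} {G : groupType} (S : seq G) (eta : R) (M : nat)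
    (F : nat -> seq G) :
    (forall k, uniq (F k)) -> F 0%N != [::] ->
    (forall k, (k < M)%N -> {subset F k <= F k.+1}) ->
    (forall k s p, (k < M)%N -> s \in S -> p \in F k -> (s * p)%g \in F k.+1) ->
    (size (F M))%:R < (1 + eta) ^+ M -> 0 <= eta ->
  exists A : seq G, [/\ uniq A, A != [::] &
    forall s, s \in S ->
      (count (fun p => (s * p)%g \notin A) A)%:R <= eta * (size A)%:R].
Proof.
move=> Fu F0 Fsub FS FM eta0.
have Fn0 k : (k <= M)%N -> F k != [::].
  elim: k => // k IH kM; have := IH (ltnW kM).
  case E : (F k) => [//|x s] _; have := Fsub _ kM x; rewrite E mem_head.
  by case: (F k.+1) => // /(_ isT).
have [k kM Fk] : exists2 k, (k < M)%N &
    (size (F k.+1))%:R <= (1 + eta) * (size (F k))%:R.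
  apply: contrapT => noF.
  suff FkM k : (k <= M)%N -> (1 + eta) ^+ k <= (size (F k))%:R.
    by have := FkM M (leqnn _); rewrite leNgt FM.
  elim: k => [|k IH] kM; first by rewrite expr0 ler1n; move: F0; case: (F 0%N).
  have [h|h] := leP ((1 + eta) * (size (F k))%:R) ((size (F k.+1))%:R : R).
    rewrite exprS (le_trans _ h)// ler_wpM2l ?IH ?(ltnW kM)//.
    by rewrite addr_ge0.
  by exfalso; apply: noF; exists k => //; exact: ltW.
exists (F k); split => // [|s sS]; first exact/Fn0/ltnW.
have sz :
    (size (F k) + count (fun p => (s * p)%g \notin F k) (F k) <= size (F k.+1))%N.
  rewrite -size_filter -(size_map (fun p => (s * p)%g)) -size_cat.
  apply: uniq_leq_size.
    rewrite cat_uniq Fu map_inj_uniq ?filter_uniq ?andbT//=; last exact: mulgI.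
    by apply/hasPn => _ /mapP[p + ->]; rewrite mem_filter => /andP[].
  move=> x; rewrite mem_cat => /orP[/(Fsub _ kM)//|/mapP[p + ->]].
  by rewrite mem_filter => /andP[_]; exact: FS.
move: sz; rewrite -(ler_nat R) natrD => sz.
by rewrite -(lerD2l (size (F k))%:R) (le_trans sz)// (le_trans Fk)//; lra.
Qed.

(** Later [J + 2] counts the slices of a tube and [s ^ r] bounds each slice. The slope [tau] lets
    [s ^ r] use at most half of the rate [ln (1 + eta)]; the linear factor fits in the other
    half. *)
Lemma subexponential {R : realType} (eta a r0 : R) (s : nat) :
    0 < eta -> 0 <= a ->
  exists2 tau : R, 0 < tau & exists M0 : nat, forall M J r : nat, (M0 <= M)%N ->
    J%:R <= a * M%:R -> r%:R <= tau * M%:R + r0 ->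
    ((J + 2) * s ^ r)%:R < (1 + eta) ^+ M.
Proof.
move=> eta0 a0; pose h : R := ln (1 + eta).
have h0 : 0 < h by rewrite ln_gt0// ltrDl.
(* This keeps [sg] positive when [s = 0], and [s <= expR sg]. *)
pose sg : R := s%:R + 1; have sg0 : 0 < sg by rewrite /sg ltr_wpDl.
exists (h / 4 / sg); first by rewrite !divr_gt0.
(* The last two entries absorb the constant [r0] and make [t ^+ 2] below dominate the linear
   factor. *)
pose K := Num.max 1 (Num.max (8 * sg * `|r0| / h) (64 * (a + 3) / (h * h))).
exists (Num.trunc K).+1 => M J r MK JM rM.
have {MK} : K <= M%:R by rewrite (le_trans (ltW (truncnS_gt _)))// ler_nat.
rewrite !ge_max => /and3P[M1 Mr Ma].
have -> : (1 + eta) ^+ M = expR (h * M%:R).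
  by rewrite mulrC expRM_natl lnK// posrE; lra.
have sexp : s%:R ^+ r <= expR (h / 2 * M%:R) :> R.
  have s1 : s%:R <= expR sg.
    by rewrite (le_trans _ (expR_ge1Dx _))// /sg; lra.
  rewrite (le_trans (lerXn2r _ _ _ s1)) ?nnegrE ?expR_ge0//.
  rewrite -expRM_natl ler_expR.
  have h1 : r%:R * sg <= (h / 4 / sg * M%:R + r0) * sg by rewrite ler_wpM2r// ltW.
  have h2 : (h / 4 / sg * M%:R + r0) * sg = h / 4 * M%:R + r0 * sg.
    by field; rewrite gt_eqF.
  have h3 : r0 * sg <= h / 4 * M%:R.
    move: Mr; rewrite ler_pdivrMr// => Mr.
    have : r0 * sg <= `|r0| * sg by rewrite ler_wpM2r ?ler_norm// ltW.
    have : 0 <= `|r0| * sg by rewrite mulr_ge0// ltW.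
    lra.
  by move: h1; rewrite h2; lra.
have Jexp : (J + 2)%:R < expR (h / 2 * M%:R) :> R.
  have -> : h / 2 * M%:R = 2%:R * (h / 4 * M%:R) by lra.
  rewrite expRM_natl; set t := h / 4 * M%:R.
  have t0 : 0 < t by rewrite /t mulr_gt0 ?divr_gt0//; lra.
  have et : t < expR t by rewrite (lt_le_trans _ (expR_ge1Dx _))//; lra.
  have tt : (a + 3) * M%:R <= t ^+ 2.
    move: Ma; rewrite ler_pdivrMr ?mulr_gt0// => Ma.
    by rewrite /t; nra.
  rewrite natrD (@lt_le_trans _ _ (t ^+ 2))//; first by nra.
  by rewrite lerXn2r ?nnegrE ?expR_ge0 ?ltW.
rewrite natrM natrX.
have -> : h * M%:R = h / 2 * M%:R + h / 2 * M%:R by lra.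
rewrite expRD (@le_lt_trans _ _ ((J + 2)%:R * expR (h / 2 * M%:R)))//.
  by rewrite ler_wpM2l// ler0n.
by rewrite ltr_pM2r ?expR_gt0.
Qed.

(** * Tubes around geodesics *)

Section NonAmenable.
Context {R : realType} {G : groupType} (d : G -> G -> R) (e : R).
Hypotheses (dM : is_metric d) (dL : left_invariant d).
Hypothesis dH : forall x y z w,
  Num.min (gromov_product d x z w) (gromov_product d z y w) - e
    <= gromov_product d x y w.
Local Notation len x := (d 1%g x).
Local Notation gp := (gromov_product d).
Context (S : seq G) (L C c : R).
Hypothesis (L0 : 0 <= L) (C0 : 0 <= C).
Hypothesis words : forall x, exists w,
  [/\ {subset w <= S}, (\prod_(s <- w) s)%g = x & (size w)%:R <= L * len x + C].
Hypotheses (S1 : 1%g \in S) (SV : forall s, s \in S -> s^-1%g \in S).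
Hypotheses (e0 : 0 <= e) (c1 : 1 <= c) (ec : e <= c).
Hypothesis cS : forall s, s \in S -> len s <= c.
Let c0 : 0 <= c. Proof. exact: le_trans ler01 c1. Qed.

Lemma len_words k v : v \in words_of_length S k -> len v <= c * k%:R.
Proof.
elim: k v => [|k IH] v.
  by rewrite inE => /eqP->; rewrite is_metric_xx ?mulr0.
move=> /words_of_lengthP[a [w [/cS aS /IH wk ->]]].
by have := lenM dM dL a w; rewrite -[k.+1%:R]natr1; lra.
Qed.

(** Each further letter costs [e] for hyperbolicity and at most [c] for moving the base point, and
    [e <= c]. *)
Lemma gp_words y K : (forall s, s \in S -> K <= gp y (s * y)%g 1%g) ->
  forall k v, v \in words_of_length S k -> K - 2 * c * k%:R <= gp y (v * y)%g 1%g.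
Proof.
have ? := ec; have ? := c0; move=> yK; elim=> [|k IH] v.
  by rewrite inE => /eqP->; have := yK _ S1; lra.
move=> /words_of_lengthP[a [w [aS /IH wk ->]]].
have ca := cS aS; have ya := yK _ aS.
have kc : 0 <= c * k%:R by rewrite mulr_ge0.
rewrite -[k.+1%:R]natr1.
have [h|h] := gp_split dH y (a * y)%g (a * w * y)%g 1%g; first by lra.
have : gp y (w * y)%g 1%g <= gp (a * y)%g (a * w * y)%g 1%g + len a.
  rewrite -[X in gp (_ * _)%g _ X](mulgV a) -mulgA gp_left// -(lenV dM dL a).
  exact: gp_lipschitz_base.
lra.
Qed.

Lemma ball_words x r : L * len x + C <= r%:R -> x \in words_of_length S r.
Proof.
move=> xr; have [w [wS wx wsz]] := words x. rewrite -wx.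
apply: (words_of_length_sub S1 _ (prod_words_of_length wS)).
by rewrite -(ler_nat R) (le_trans wsz).
Qed.

(* [gp 1 y p <= E] says that [p] is [E]-close to a geodesic from [1] to [y]. *)
Lemma tube_close y E p q : gp 1%g y p <= E -> gp 1%g y q <= E ->
  `|len p - len q| <= 1 -> len (q^-1 * p)%g <= 2 * E + 1 + 2 * e.
Proof.
move=> pE qE; rewrite ler_norml => /andP[pq1 pq2]; rewrite -dist_len//.
have := four_point dM dH q 1%g p y; move: pE qE; rewrite /gromov_product.
rewrite (is_metricC dM p 1%g) (is_metricC dM q 1%g).
by move=> pE qE [h|h]; lra.
Qed.

(** The tube is cut into slices by the integer part of [len p]; by [tube_close], each slice lies in
    a translate of a ball listed by [words_of_length S r]. *)
Lemma tube_cover y E t (J r : nat) : t < (J + 2)%:R ->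
  L * (2 * E + 1 + 2 * e) + C <= r%:R ->
  exists2 l : seq G, size l = ((J + 2) * size S ^ r)%N &
    forall p, len p <= t -> gp 1%g y p <= E -> p \in l.
Proof.
move=> tJ Er.
have /choice[q qP] : forall i : nat, exists q, forall p, gp 1%g y p <= E ->
    i%:R <= len p < i.+1%:R -> (q^-1 * p)%g \in words_of_length S r.
  move=> i; have [[q [qE qi]]|noq] := pselect (exists q, gp 1%g y q <= E /\
      i%:R <= len q < i.+1%:R).
    exists q => p pE pi; apply: ball_words; rewrite (le_trans _ Er)// lerD2r.
    apply/ler_wpM2l => //; apply: tube_close pE qE _.
    rewrite ler_norml; move: pi qi; rewrite -natr1 => /andP[? ?] /andP[? ?].
    by apply/andP; split; lra.
  (* An empty slice gets an arbitrary centre. *)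
  by exists 1%g => p pE pi; exfalso; apply: noq; exists p.
exists [seq (q i * w)%g | i <- iota 0 (J + 2), w <- words_of_length S r].
  by rewrite size_allpairs size_iota size_words_of_length.
move=> p pt pE; pose i := Num.trunc (len p).
have len0 := is_metric_ge0 dM 1%g p.
have pi : i%:R <= len p < i.+1%:R.
  by apply/andP; split; [rewrite truncn_le|rewrite truncnS_gt].
apply/allpairsP; exists (i, (q i)^-1 * p)%g; split => /=; last by rewrite mulVKg.
  rewrite mem_iota add0n/= -(ltr_nat R) (le_lt_trans _ tJ)// (le_trans _ pt)//.
  by case/andP: pi.
exact: qP.
Qed.

Section Chain.
Context (y : G) (E K : R) (M : nat).

(* Points near a geodesic joining points close to [1] and [y]; the slack grows
   with [k] so that translation by a generator maps one set into the next. *)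
Definition tube k p := exists u v,
  [/\ u \in words_of_length S k, v \in words_of_length S k,
      gp u (v * y)%g p <= E,
      c * (4 * M%:R - k%:R) <= len p & len p <= c * (6 * M%:R + k%:R)].

Lemma tubeS k s p : s \in S -> tube k p -> tube k.+1 (s * p)%g.
Proof.
move=> sS [u [v [uk vk uvp p1 p2]]]; have ? := c0; exists (s * u)%g, (s * v)%g.
have := lenM dM dL s p; have := lenM dM dL s^-1%g (s * p)%g.
rewrite mulKg (lenV dM dL) -[k.+1%:R]natr1; have := cS sS => h1 h2 h3.
by split; rewrite ?words_of_lengthS// -?mulgA ?gp_left//; lra.
Qed.

Hypotheses (yK : forall s, s \in S -> K <= gp y (s * y)%g 1%g).
Hypotheses (KM : 12 * c * M%:R <= K) (EM : E <= c * M%:R) (eM : 2 * e < c * M%:R).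

(** Replacing the ends [u] and [v * y] by [1] and [y] costs [e] each: seen from [p], the products of
    [u] with [1] and of [y] with [v * y] are at least [2 * c * M] and [3 * c * M], which exceed
    [E + 2 * e]. *)
Lemma tube_sub k p : (k <= M)%N -> tube k p ->
  len p <= 7 * c * M%:R /\ gp 1%g y p <= E + 2 * e.
Proof.
have ? := c0; have ? := EM; have ? := KM; have ? := eM.
rewrite -(ler_nat R) => kM [u [v [uk vk uvp p1 p2]]].
have ckM : c * k%:R <= c * M%:R by rewrite ler_wpM2l.
split; first lra.
have lu := len_words uk; have gv := gp_words yK vk.
have gup : len p - len u <= gp u 1%g p.
  have := is_metric_triangle dM u 1%g p; rewrite /gromov_product.
  by rewrite (is_metricC dM p u) (is_metricC dM p 1%g) (is_metricC dM u 1%g); lra.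
have gvp : gp y (v * y)%g 1%g - len p <= gp y (v * y)%g p.
  by have := gp_lipschitz_base dM y (v * y)%g 1%g p; lra.
have [h|h] := gp_split dH u 1%g (v * y)%g p; first lra.
have [h'|h'] := gp_split dH 1%g y (v * y)%g p; lra.
Qed.

End Chain.

(** For a given [eta] the choices are made in the order [tau], [eps], [M], [y]; the tubes at
    distance about [5 * c * M] from [1] then feed [chain_folner]. *)
Lemma nonamenable_gp_bounded : ~ amenable R G ->
  exists K : R, forall y, exists2 s, s \in S & gp y (s * y)%g 1%g <= K.
Proof.
have ? := e0; have ? := c1; have ? := c0; have ? := L0; have ? := ec.
have ? := C0.
move=> namen; apply: contrapT => noK; apply: namen.
have far K : exists y, forall s, s \in S -> K < gp y (s * y)%g 1%g.
  apply: contrapT => noy; apply: noK; exists K => y; apply: contrapT => nos.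
  apply: noy; exists y => s sS; rewrite ltNge; apply/negP => h.
  by apply: nos; exists s.
apply: (folner_amenable (S := S)) => //.
  by move=> x; have [w [wS wx _]] := words x; exists w.
move=> eta eta0.
have ca0 : 0 <= 7 * c by lra.
(* The constant collects the part of the radius [r] below that does not involve [E], and 1 for
   rounding. *)
have [tau tau0 [M0 M0P]] :=
  subexponential (L * (6 * e + 1) + C + 1) (size S) eta0 ca0.
(* The point [y] below has [len y <= 180 c M], so this [eps] makes the midpoint
   error [eps * len y] at most [c M], and also small against [tau * M / L]. *)
pose eps := Num.min (180^-1) (tau / (360 * (L + 1) * c)).
have Lc0 : 0 < 360 * (L + 1) * c by rewrite !mulr_gt0//; lra.
have eps0 : 0 < eps by rewrite lt_min divr_gt0// andbT; lra.
have eps1 : eps <= 180^-1 by rewrite ge_min lexx.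
have eps2 : L * (360 * eps * c) <= tau.
  have : eps <= tau / (360 * (L + 1) * c) by rewrite ge_min lexx orbT.
  rewrite ler_pdivlMr// => h; rewrite (le_trans _ h)//.
  rewrite (_ : eps * _ = L * (360 * eps * c) + 360 * eps * c); last by ring.
  by rewrite lerDl !mulr_ge0//; lra.
have [N1 N11 mid] := rough_midpoint dM dL dH L0 C0 words eps0.
have [N2 N21 trunc] := rough_truncation dM dL dH L0 C0 words.
pose M := maxn M0 (Num.trunc (Num.max (2 * e) (Num.max N1 N2))).+1.
have MB : Num.max (2 * e) (Num.max N1 N2) < M%:R.
  by rewrite (lt_le_trans (truncnS_gt _))// ler_nat leq_maxr.
have {MB} [Me MN1 MN2] : [/\ 2 * e < M%:R, N1 < M%:R & N2 < M%:R].
  by move: MB; rewrite !gt_max => /andP[-> /andP[-> ->]].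
have MM0 : (M0 <= M)%N by rewrite leq_maxl.
have McM : M%:R <= c * M%:R by rewrite ler_peMl ?ler0n.
have cM1 : c <= c * M%:R by rewrite ler_peMr//; lra.
pose N := 60 * c * M%:R.
have [y0 y0N] := far N.
have Ny0 : N <= len y0.
  by rewrite (le_trans (ltW (y0N _ S1)))// gp_le_dist.
(* While [far] bounds [len y0] only from below, midpoint errors are proportional to the length;
   hence this replacement of [y0] by [y]. *)
have [y [Ny yN yy0]] : exists p,
  [/\ N <= len p, len p <= 3 * N & len p / 4 <= gp p y0 1%g].
  by apply: trunc => //; rewrite /N; lra.
pose E := eps * len y.
(* Passing through [y0] and [s * y0] leaves at least [15 * c * M - c - 2 * e], where 15 is a quarter
   of the 60 in [N]. *)
have yK s : s \in S -> 12 * c * M%:R <= gp y (s * y)%g 1%g.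
  move=> sS; have cs := cS sS; have h0 := y0N _ sS.
  have h1 : gp y y0 1%g - c <= gp (s * y0)%g (s * y)%g 1%g.
    rewrite -[X in gp (s * _)%g _ X](mulgV s) gp_left// gpC//.
    by have := gp_lipschitz_base dM y0 y 1%g s^-1%g; rewrite lenV//; lra.
  move: Ny; rewrite /N => Ny.
  have [h|h] := gp_split dH y y0 (s * y)%g 1%g; first lra.
  have [h'|h'] := gp_split dH y0 (s * y0)%g (s * y)%g 1%g; first lra.
  lra.
have EM : E <= c * M%:R.
  have : E <= 180^-1 * (3 * N) by rewrite ler_pM ?is_metric_ge0// ltW.
  by rewrite /N; lra.
have E2 : L * (2 * E) <= tau * M%:R.
  have : eps * len y <= eps * (3 * N) by rewrite ler_pM2l.
  rewrite -/E /N => h.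
  rewrite (@le_trans _ _ (L * (360 * eps * c) * M%:R))//; last first.
    by rewrite ler_wpM2r.
  by rewrite -mulrA ler_wpM2l//; lra.
(* The error [E] is at most [c * M], so the length of [p0] lies between [4 * c * M] and [6 * c * M],
   as the first tube requires. *)
have [p0 [p01 p02]] : exists p, len p <= 5 * c * M%:R + eps * len y /\
    d p y <= len y - 5 * c * M%:R + eps * len y.
  by apply: mid; move: Ny; rewrite /N; [lra|move=> ?; apply/andP; split; lra].
have p0y := is_metric_triangle dM p0 1%g y.
have tube0 : tube y E M 0 p0.
  exists 1%g, 1%g; rewrite !inE mul1g eqxx /gromov_product; split => //.
  - by rewrite (is_metricC dM p0 1%g) /E; lra.
  - by move: EM; rewrite /E; lra.
  - by move: EM; rewrite /E; lra.
have eM : 2 * e < c * M%:R by lra.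
pose J := Num.trunc (7 * c * M%:R).
pose X := L * (2 * (E + 2 * e) + 1 + 2 * e) + C.
pose r := (Num.trunc X).+1.
have E0 : 0 <= E by rewrite mulr_ge0 ?is_metric_ge0// ltW.
have X0 : 0 <= X by rewrite addr_ge0// mulr_ge0//; lra.
have [||l lsz lP] := @tube_cover y (E + 2 * e) (7 * c * M%:R) J r.
- by rewrite (lt_trans (truncnS_gt _))// ltr_nat addn2.
- by rewrite ltW// truncnS_gt.
(* By [tube_sub] the list [l] contains every tube with [k <= M], so filtering loses nothing. *)
pose F k := [seq p <- undup l | `[< tube y E M k p >]].
have FP k p : (k <= M)%N -> (p \in F k) = `[< tube y E M k p >].
  move=> kM; rewrite mem_filter mem_undup andb_idr// => /asboolP pk.
  by have [pt pE] := tube_sub yK (lexx _) EM eM kM pk; apply: lP.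
apply: (@chain_folner _ _ S eta M F) => //; last exact: ltW.
- by move=> k; rewrite filter_uniq// undup_uniq.
- have : p0 \in F 0%N by rewrite FP//; apply/asboolP.
  by case: (F 0%N).
- move=> k kM p; rewrite !FP// ?(ltnW kM)// => /asboolP pk; apply/asboolP.
  by rewrite -[p]mul1g; apply: tubeS.
- move=> k s p kM sS; rewrite !FP// ?(ltnW kM)// => /asboolP pk; apply/asboolP.
  exact: tubeS.
- apply: le_lt_trans (M0P M J r MM0 _ _).
  + by rewrite ler_nat -lsz size_filter (leq_trans (count_size _ _))// size_undup.
  + by rewrite truncn_le//; lra.
  + rewrite /r -natr1; have : (Num.trunc X)%:R <= X by rewrite truncn_le.
    by rewrite /X; lra.
Qed.

End NonAmenable.

(** * Comparison with words and exponential growth *)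

(** Word length is an infimum and the word is chosen within 1 of it, whence [C + 1]; adding [1] to
    the generators makes the lists [words_of_length] increase with the length. *)
Lemma hyperbolic_class_words {R : realType} {G : groupType} (d : G -> G -> R) :
    hyperbolic_metric_class d ->
  exists (S : seq G) (L C : R), [/\ 0 <= L, 0 <= C, 1%g \in S,
    forall s, s \in S -> s^-1%g \in S &
    forall x, exists w,
      [/\ {subset w <= S}, (\prod_(s <- w) s)%g = x &
          (size w)%:R <= L * d 1%g x + C]].
Proof.
case=> _ _ _ [S0 [/finite_seqP[S ->] SV gen] [L [C [L0 C0 qi]]]].
exists (1%g :: S), L, (C + 1); split; rewrite ?mem_head//.
- exact: ltW.
- by rewrite addr_ge0.
- by move=> s; rewrite !inE => /predU1P[->|/SV /= ->]; rewrite ?invg1 ?eqxx ?orbT.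
move=> x; have [_] := qi 1%g x.
rewrite /word_metric invg1 mul1g /word_length => le_inf.
have [|_ [w [wS wx] <-] wlt] := @inf_adherent _
    [set ((size w)%:R : R) | w in is_word_for [set` S] x] 1 ltr01.
  split; first by have [w wx] := gen x; exists (size w)%:R, w.
  by exists 0 => _ [w _ <-]; rewrite ler0n.
exists w; split => //; first by move=> s /wS /= sS; rewrite inE sS orbT.
by rewrite ltW// (lt_le_trans wlt)//; lra.
Qed.

Lemma hyperbolic_class_bounded_ratio {R : realType} {G : groupType}
    (d ds : G -> G -> R) :
    hyperbolic_metric_class d -> is_metric ds -> left_invariant ds ->
  exists A B : R, [/\ 0 <= A, 0 <= B & forall x, ds 1%g x <= A * d 1%g x + B].
Proof.
move=> /hyperbolic_class_words[S [L [C [L0 C0 _ _ words]]]] dsM dsL.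
have [c c0 cS] := seq_bounded S (fun s => ds 1%g s).
exists (c * L), (c * C); split; rewrite ?mulr_ge0// => x.
have [w [wS wx wsz]] := words x.
have : ds 1%g x <= c * (size w)%:R.
  rewrite -wx; elim: w wS {wx wsz} => [|a w IH] wS.
    by rewrite big_nil is_metric_xx// mulr0.
  rewrite big_cons (le_trans (lenM dsM dsL _ _))//.
  rewrite -[(size _)%:R]natr1 mulrDr mulr1 addrC lerD ?cS ?wS ?mem_head//.
  by rewrite IH// => s sw; rewrite wS// inE sw orbT.
by move=> /le_trans; apply; rewrite -mulrA -mulrDr ler_wpM2l.
Qed.

(** At most [size S ^ M] points have [n x = M], so the levels are dominated by a geometric series of
    ratio 1/2. *)
Lemma sum_words {R : realType} {G : groupType} (S : seq G) (q : R) (n : G -> nat)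
    (s : seq G) :
    0 <= q -> (size S)%:R * q <= 2^-1 ->
    (forall x, x \in words_of_length S (n x)) -> uniq s ->
  \sum_(x <- s) q ^+ n x <= 2.
Proof.
move=> q0 Sq nP us.
have aux M : \sum_(x <- s | (n x < M)%N) q ^+ n x <= 2 - 2 * 2^-1 ^+ M.
  elim: M => [|M IH]; first by rewrite big_pred0// expr0; lra.
  rewrite (bigID (fun x => n x == M))/=.
  have -> : \sum_(x <- s | (n x < M.+1)%N && (n x == M)) q ^+ n x =
      (count (fun x => n x == M) s)%:R * q ^+ M.
    rewrite (eq_bigl (fun x => n x == M)); last first.
      by move=> x; case: eqP => [->|_]; rewrite ?ltnSn ?andbF.
    rewrite (eq_bigr (fun=> q ^+ M)); last by move=> x /eqP->.
    by rewrite big_const_seq iter_addr_0 mulr_natl.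
  rewrite (eq_bigl (fun x => (n x < M)%N)); last first.
    by move=> x; rewrite ltnS [RHS]ltn_neqAle andbC.
  have cM : (count (fun x => n x == M) s)%:R * q ^+ M <= 2^-1 ^+ M.
    rewrite (@le_trans _ _ (((size S)%:R * q) ^+ M))//; last first.
      by rewrite lerXn2r// nnegrE ?mulr_ge0// invr_ge0.
    rewrite exprMn ler_wpM2r ?exprn_ge0// -natrX ler_nat.
    rewrite -size_words_of_length -size_filter uniq_leq_size ?filter_uniq//.
    by move=> x; rewrite mem_filter => /andP[/eqP <-].
  by rewrite exprS; lra.
have [M MP] : exists M, forall x, x \in s -> (n x < M)%N.
  elim: s {us aux} => [|a s [M MP]]; first by exists 0%N.
  exists (maxn (n a).+1 M) => x; rewrite inE leq_max => /predU1P[->|/MP ->].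
    by rewrite leqnn.
  by rewrite orbT.
rewrite big_seq (eq_bigl (fun x => (x \in s) && (n x < M)%N)); last first.
  by move=> x; case: (boolP (x \in s)) => // /MP ->.
rewrite -big_seq_cond (le_trans (aux M))// lerBlDr lerDl.
by rewrite mulr_ge0// exprn_ge0// invr_ge0.
Qed.

Lemma exp_growth {R : realType} {G : groupType} (d : G -> G -> R) :
    hyperbolic_metric_class d -> exists h B : R,
  forall s : seq G, uniq s -> \sum_(x <- s) expR (- h * d 1%g x) <= B.
Proof.
move=> /hyperbolic_class_words[S [L [C [L0 C0 S1 _ words]]]].
have /choice[n nP] : forall x, exists n, x \in words_of_length S n /\
    n%:R <= L * d 1%g x + C.
  move=> x; have [w [wS wx wsz]] := words x; exists (size w); split => //.
  by rewrite -{1}wx prod_words_of_length.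
(* As [expR g] is at least [1 + g], it is at least twice [size S]. *)
pose g : R := 2 * (size S)%:R; exists (g * L), (expR (g * C) * 2) => s us.
have Sg : (size S)%:R * expR (- g) <= 2^-1 :> R.
  have g0 : (0 : R) < 2 * (size S)%:R by rewrite mulr_gt0// ltr0n; case: (S) S1.
  rewrite expRN ler_pdivrMr ?expR_gt0//.
  have := expR_ge1Dx g; rewrite /g; lra.
rewrite (@le_trans _ _ (\sum_(x <- s) expR (g * C) * expR (- g) ^+ n x))//.
  apply: ler_sum => x _; rewrite -expRM_natl -expRD ler_expR.
  have g0 : 0 <= g by rewrite mulr_ge0.
  have [_ nx] := nP x; have := ler_wpM2l g0 nx; lra.
rewrite -mulr_sumr ler_wpM2l ?expR_ge0//.
by apply: (sum_words (S := S)) => // x; have [] := nP x.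
Qed.

Lemma esum_EFin_le {R : realType} {T : choiceType} (f : T -> R) (B : R) :
  (forall s, uniq s -> \sum_(x <- s) f x <= B) ->
  (\esum_(x in [set: T]) (f x)%:E <= B%:E)%E.
Proof.
move=> fB; apply: ge_ereal_sup => _ [A [/finite_seqP[s ->] _] <-].
rewrite (_ : [set` s] = [set` undup s]); last first.
  by apply/seteqP; split=> x /=; rewrite mem_undup.
by rewrite -fsbig_seq ?undup_uniq// sumEFin lee_fin fB ?undup_uniq.
Qed.

Lemma esum_EFin_ge {R : realType} {T : choiceType} (f : T -> R) (s : seq T) :
  uniq s -> ((\sum_(x <- s) f x)%:E <= \esum_(x in [set: T]) (f x)%:E)%E.
Proof.
move=> us; apply: esum_ge; exists [set` s]; last by rewrite -fsbig_seq// sumEFin.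
by split => //; apply/finite_seqP; exists s.
Qed.

(** * The Manhattan curve *)

Section Theta.
Context {R : realType} {G : groupType} (d ds : G -> G -> R).
Hypotheses (dM : is_metric d) (dL : left_invariant d).
Hypotheses (dsM : is_metric ds) (dsL : left_invariant ds).
Local Notation len x := (d 1%g x).
Local Notation lens x := (ds 1%g x).
Local Notation tlen := (translation_length d).
Local Notation tlens := (translation_length ds).

Lemma expg_inj x : 0 < tlen x -> injective (fun n => x ^+ n)%g.
Proof.
move=> x0; suff lt_neq m n : (m < n)%N -> (x ^+ m)%g <> (x ^+ n)%g.
  by move=> m n /= mn; case: (ltngtP m n) => // /lt_neq h; exfalso; apply: h.
move=> mn xmn; have [_ _ /(_ (n - m)%N)] := translation_length_cvg dM dL x.
rewrite expgnFr ?(ltnW mn)// -xmn mulgV is_metric_xx// leNgt mulr_gt0//.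
by rewrite ltr0n subn_gt0.
Qed.

(* The powers of [x] alone already force divergence below this value. *)
Lemma theta_ge (a : R) x :
  0 < tlen x -> ((- a * (tlens x / tlen x))%:E <= theta d ds a)%E.
Proof.
move=> x0; apply: le_ereal_inf_tmp => _ [b bfin <-]; rewrite lee_fin leNgt.
apply/negP => bx; pose f y := expR (- a * lens y - b * len y).
have neg : a * tlens x + b * tlen x < 0.
  by move: bx; rewrite mulrA ltr_pdivlMr//; lra.
(* Divided by [n], the opposite of the exponent in [f (x ^+ n)] tends to the negative number of
   [neg]. *)
have [N NP] : exists N, forall n, (N <= n)%N -> 1 <= f (x ^+ n)%g.
  have [cv _ _] := translation_length_cvg dM dL x.
  have [cvs _ _] := translation_length_cvg dsM dsL x.
  have [N _ NP] :=
    cvgr_le _ (cvgD (cvgM (cvg_cst a) cvs) (cvgM (cvg_cst b) cv)) _ neg.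
  exists N.+1 => n Nn; rewrite -expR0 ler_expR.
  have n0 : (0 : R) < n%:R by rewrite ltr0n (leq_trans _ Nn).
  have {NP} :
      a * (n%:R^-1 * lens (x ^+ n)%g) + b * (n%:R^-1 * len (x ^+ n)%g) <= 0 :=
    NP n (ltnW Nn).
  rewrite (mulrCA a) (mulrCA b) -mulrDr pmulr_rle0 ?invr_gt0//; lra.
have sumN m : m%:R <= \sum_(y <- [seq (x ^+ n)%g | n <- iota N m]) f y.
  rewrite big_map -[m in m%:R](size_iota N) -sum1_size natr_sum.
  rewrite big_seq [leRHS]big_seq.
  by apply: ler_sum => n; rewrite mem_iota => /andP[/NP].
have {}bfin : (\esum_(y in [set: G]) (f y)%:E < +oo)%E := bfin.
move: bfin.
have : (0 <= \esum_(y in [set: G]) (f y)%:E)%E.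
  by apply: esum_ge0 => y _; rewrite lee_fin expR_ge0.
have := @esum_EFin_ge _ _ f.
case: (\esum_(y in [set: G]) (f y)%:E)%E => // r h _ _.
(* More than [r] distinct powers, each contributing at least 1, exceed the supposed sum [r]. *)
have := h [seq (x ^+ n)%g | n <- iota N (Num.trunc r).+1].
rewrite lee_fin map_inj_uniq ?iota_uniq//; last exact: expg_inj.
by move=> /(_ isT) /(le_trans (sumN _)); rewrite leNgt truncnS_gt.
Qed.

(** At [b = h - a * k] each term is at most [expR c] times a term of the growth series. Keeping the
    factor [a] in the comparison serves both signs of [a]. *)
Lemma theta_le (a k c h B : R) :
    (forall s : seq G, uniq s -> \sum_(x <- s) expR (- h * len x) <= B) ->
    (forall x, a * k * len x <= a * lens x + c) ->
  (theta d ds a <= (h - a * k)%:E)%E.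
Proof.
move=> hB ak; apply: ereal_inf_lbound; exists (h - a * k) => //=.
apply: (@le_lt_trans _ _ (expR c * B)%:E); last by rewrite ltry.
apply: esum_EFin_le => s us.
rewrite (@le_trans _ _ (\sum_(x <- s) expR c * expR (- h * len x)))//.
  by apply: ler_sum => x _; rewrite -expRD ler_expR; have := ak x; lra.
by rewrite -mulr_sumr ler_wpM2l ?expR_ge0// hB.
Qed.

End Theta.

(** * Consequences of non-amenability *)

Lemma hyperbolic_class_nearby {R : realType} {G : groupType} (d : G -> G -> R) :
    hyperbolic_metric_class d -> ~ amenable R G ->
  exists2 C : R, 0 <= C & forall x, exists2 g,
    d x g <= C & d 1%g x - C <= translation_length d g.
Proof.
move=> dD namen; have [dM dL [e e0 dH] _] := dD.
have [S [L [C [L0 C0 S1 SV words]]]] := hyperbolic_class_words dD.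
have [c c0 cS] := seq_bounded S (fun s => d 1%g s).
have [||s sS|K KP] := nonamenable_gp_bounded (c := Num.max 1 (Num.max e c))
    dM dL dH L0 C0 words S1 SV e0 _ _ _ namen.
- by rewrite le_max lexx.
- by rewrite !le_max lexx orbT.
- by rewrite !le_max cS ?orbT.
have [C' C'P] := nearby_translation_length dM dL dH KP.
exists C' => //; have [g dg _] := C'P 1%g.
by apply: le_trans dg; exact: is_metric_ge0.
Qed.

(** If [d] were bounded, one ball of words would be the whole group, which would then be finite and
    its own Folner set. *)
Lemma nonamenable_unbounded {R : realType} {G : groupType} (d : G -> G -> R) :
    hyperbolic_metric_class d -> ~ amenable R G ->
  forall B : R, exists x, B < d 1%g x.
Proof.
move=> dD namen B; apply: contrapT => bnd; apply: namen.
have [S [L [C [L0 C0 S1 SV words]]]] := hyperbolic_class_words dD.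
apply: (folner_amenable (S := S)) => //.
  by move=> x; have [w [wS wx _]] := words x; exists w.
pose r := (Num.trunc (L * B + C)).+1.
have all_in x : x \in words_of_length S r.
  have [w [wS wx wsz]] := words x.
  rewrite -wx; apply: (words_of_length_sub S1 _ (prod_words_of_length wS)).
  rewrite -(ler_nat R) (le_trans wsz)// (le_trans _ (ltW (truncnS_gt _)))//.
  rewrite lerD2r ler_wpM2l// leNgt; apply/negP => Bx.
  by apply: bnd; exists x.
move=> eta eta0; exists (undup (words_of_length S r)); split.
- exact: undup_uniq.
- have := all_in 1%g; rewrite -mem_undup; case: (undup _) => //.
move=> s sS.
rewrite (eq_count (a2 := pred0)) ?count_pred0 ?mulr_ge0 ?(ltW eta0)//.
by move=> p; rewrite /= mem_undup all_in.
Qed.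

(** * The two dilation constants *)

Section Dilation.
Context {R : realType} {G : groupType} (d ds : G -> G -> R).
Hypotheses (dD : hyperbolic_metric_class d) (dsD : hyperbolic_metric_class ds).
Local Notation tlen := (translation_length d).
Local Notation tlens := (translation_length ds).

Let dM : is_metric d. Proof. by case: dD. Qed.
Let dL : left_invariant d. Proof. by case: dD. Qed.
Let dsM : is_metric ds. Proof. by case: dsD. Qed.
Let dsL : left_invariant ds. Proof. by case: dsD. Qed.

Definition ratios : set R := [set tlens x / tlen x | x in [set x | 0 < tlen x]].

(** Translation lengths are invariant under conjugation, so the representative chosen by [xget] is
    irrelevant and elements replace classes. *)
Lemma class_ratios :
  [set (class_ratio d ds c)%:E | c in conj_pos d] = [set r%:E | r in ratios].
Proof.
have clE (x : G) : exists g, xget 1%g (conj_class x) = (x ^ g)%g.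
  have [g _ xg] : conj_class x (xget 1%g (conj_class x)).
    by apply: xgetPex; exists (x ^ 1)%g, 1%g.
  by exists g.
apply/seteqP; split => [_ [c [[x _ <-] pos] <-]|_ [_ [x pos <-] <-]].
  exists (class_ratio d ds (conj_class x)) => //.
  by exists (xget 1%g (conj_class x)).
have [g xg] := clE x.
have tE : class_translation_length d (conj_class x) = tlen x.
  by rewrite /class_translation_length xg translation_length_conj.
have tsE : class_translation_length ds (conj_class x) = tlens x.
  by rewrite /class_translation_length xg translation_length_conj.
exists (conj_class x); first by split; [exists x | rewrite tE].
by rewrite /class_ratio tE tsE.
Qed.

(** Besides bounding the ratios, this gives [tlens x = 0] whenever [tlen x = 0]. *)
Lemma tlens_le : exists2 A : R, 0 <= A & forall x, tlens x <= A * tlen x.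
Proof.
have [A [B [A0 _ AB]]] := hyperbolic_class_bounded_ratio dD dsM dsL.
exists A => // x; apply: (@translation_length_lb _ _ _ dM dL _ _ _ B) => n.
have [_ _ /(_ n) h] := translation_length_cvg dsM dsL x.
exact: le_trans (AB _).
Qed.

Lemma ratios_lbound : lbound ratios 0.
Proof.
move=> _ [x x0 <-]; rewrite divr_ge0 ?(ltW x0)//.
exact: translation_length_ge0.
Qed.

Lemma ratios_has_ubound : has_ubound ratios.
Proof.
have [A A0 tA] := tlens_le; exists A => _ [x x0 <-].
by rewrite ler_pdivrMr.
Qed.

Hypothesis namen : ~ amenable R G.

Lemma ratios_nonempty : ratios !=set0.
Proof.
have [C C0 near] := hyperbolic_class_nearby dD namen.
have [x xC] := nonamenable_unbounded dD namen C.
have [g _ gx] := near x; exists (tlens g / tlen g), g => //=.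
by apply: lt_le_trans gx; rewrite subr_gt0.
Qed.

Lemma inf_ratios_le x : inf ratios * tlen x <= tlens x.
Proof.
have := translation_length_ge0 dM dL x; rewrite le_eqVlt => /predU1P[<-|x0].
  by rewrite mulr0; exact: translation_length_ge0.
rewrite -ler_pdivlMr//; apply: ge_inf; first by exists 0; exact: ratios_lbound.
by exists x.
Qed.

Lemma le_sup_ratios x : tlens x <= sup ratios * tlen x.
Proof.
have [A A0 /(_ x)] := tlens_le.
have := translation_length_ge0 dM dL x; rewrite le_eqVlt => /predU1P[<-|x0].
  by rewrite !mulr0.
move=> _; rewrite -ler_pdivrMr//.
apply: ub_le_sup; first exact: ratios_has_ubound.
by exists x.
Qed.

(** A nearby [g] has [tlen g] almost equal to the length of [x] or larger, while [tlens g] is at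
    most the [ds]-length of [g], which is close to that of [x]. *)
Lemma ds_lower : exists c : R, forall x, inf ratios * d 1%g x <= ds 1%g x + c.
Proof.
have [A [B [A0 B0 AB]]] := hyperbolic_class_bounded_ratio dD dsM dsL.
have [C C0 near] := hyperbolic_class_nearby dD namen.
have m0 : 0 <= inf ratios.
  by apply: lb_le_inf; [exact: ratios_nonempty|exact: ratios_lbound].
exists (A * C + B + inf ratios * C) => x; have [g dg gx] := near x.
have dsg : ds x g <= A * C + B.
  rewrite dist_len// (le_trans (AB _))// lerD2r ler_wpM2l//.
  by rewrite -dist_len.
have := ler_wpM2l m0 gx; have := inf_ratios_le g.
have := translation_length_le dsM dsL g.
by have := is_metric_triangle dsM x 1%g g; lra.
Qed.

(** The mirror argument, with [g] now chosen for [ds]. *)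
Lemma ds_upper : exists c : R, forall x, ds 1%g x <= sup ratios * d 1%g x + c.
Proof.
have [A [B [A0 B0 AB]]] := hyperbolic_class_bounded_ratio dsD dM dL.
have [C C0 near] := hyperbolic_class_nearby dsD namen.
have [r rP] := ratios_nonempty.
have m0 : 0 <= sup ratios.
  rewrite (le_trans (ratios_lbound rP))//.
  by apply: ub_le_sup => //; exact: ratios_has_ubound.
exists (C + sup ratios * (A * C + B)) => x; have [g dsg gx] := near x.
have dg : d x g <= A * C + B.
  rewrite dist_len// (le_trans (AB _))// lerD2r ler_wpM2l//.
  by rewrite -dist_len.
have h : tlen g <= d 1%g x + (A * C + B).
  have := translation_length_le dM dL g.
  by have := is_metric_triangle dM x 1%g g; lra.
have := ler_wpM2l m0 h; have := le_sup_ratios g; lra.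
Qed.

(** The supremum of [- a * r] over the ratios [r] is [- a * inf ratios] or [- a * sup ratios]
    according to the sign of [a], and [theta] exceeds it by at most [h]. Division by a negative [a]
    reverses the bounds. *)
Lemma theta_slope_bounds : exists h : R, forall a,
  (0 < a -> ((- inf ratios)%:E <= theta_slope d ds a <=
    (h * a^-1 - inf ratios)%:E)%E) /\
  (a < 0 -> ((h * a^-1 - sup ratios)%:E <= theta_slope d ds a <=
    (- sup ratios)%:E)%E).
Proof.
have [h [B hB]] := exp_growth dD.
have [c1 lower] := ds_lower; have [c2 upper] := ds_upper.
have [r0 [x0 x0P _]] := ratios_nonempty.
exists h => a; split => a0.
- have ub : (theta d ds a <= (h - a * inf ratios)%:E)%E.
    apply: (theta_le (c := a * c1) hB) => x.
    by have := ler_wpM2l (ltW a0) (lower x); lra.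
  have lb x : 0 < tlen x -> ((- a * (tlens x / tlen x))%:E <= theta d ds a)%E.
    exact: theta_ge.
  have := lb _ x0P; rewrite /theta_slope.
  (* The value [+oo] is excluded by [ub], and [-oo] by the lower bound at [x0]. *)
  case: (theta d ds a) ub lb => [t|//|//]; rewrite !lee_fin => ub lb _.
  have {}lb : - a * inf ratios <= t.
    rewrite mulNr lerNl -ler_pdivrMl//.
    apply: lb_le_inf; first exact: ratios_nonempty.
    move=> _ [x xP <-]; rewrite ler_pdivrMl// lerNl -mulNr.
    by have := lb _ xP; rewrite lee_fin.
  rewrite ler_pdivlMr// ler_pdivrMr// mulrBl divfK ?gt_eqF//.
  by apply/andP; split; lra.
- have ub : (theta d ds a <= (h - a * sup ratios)%:E)%E.
    apply: (theta_le (c := - a * c2) hB) => x.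
    have na0 : 0 <= - a by lra.
    by have := ler_wpM2l na0 (upper x); lra.
  have lb x : 0 < tlen x -> ((- a * (tlens x / tlen x))%:E <= theta d ds a)%E.
    exact: theta_ge.
  have := lb _ x0P; rewrite /theta_slope.
  case: (theta d ds a) ub lb => [t|//|//]; rewrite !lee_fin => ub lb _.
  have na0 : 0 < - a by lra.
  have {}lb : - a * sup ratios <= t.
    rewrite -ler_pdivlMl//.
    apply: ge_sup; first exact: ratios_nonempty.
    move=> _ [x xP <-]; rewrite ler_pdivlMl//.
    by have := lb _ xP; rewrite lee_fin.
  rewrite ler_ndivlMr// ler_ndivrMr// mulrBl divfK ?lt_eqF//.
  by apply/andP; split; lra.
Qed.

End Dilation.

(** * Limits of the slopes *)

Lemma cvg_inv_pinfty {R : realType} : (a^-1 : R) @[a --> +oo] --> (0 : R).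
Proof.
apply/gtr0_cvgV0; last exact: cvg_id.
exact: nbhs_pinfty_gt.
Qed.

Lemma cvg_inv_ninfty {R : realType} : (a^-1 : R) @[a --> -oo] --> (0 : R).
Proof.
apply/ltr0_cvgV0; last exact: cvg_id.
exact: nbhs_ninfty_lt.
Qed.

(** Convergence to real limits is asserted separately, because [lim] is a total function and the two
    equalities alone would not contain it. *)
Theorem corollary3p3 (R : realType) (Gamma : groupType)
    (hGamma : non_elementary_hyperbolic R Gamma)
    (d ds : Gamma -> Gamma -> R)
    (hd : hyperbolic_metric_class d) (hds : hyperbolic_metric_class ds) :
  [/\ exists l : R, theta_slope d ds a @[a --> +oo] --> l%:E,
      exists l : R, theta_slope d ds a @[a --> -oo] --> l%:E,
      Dil_minus d ds = alpha_min d ds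
    & Dil_plus d ds = alpha_max d ds].
Proof.
have [_ namen] := hGamma.
have [h hP] := theta_slope_bounds hd hds namen.
set m := inf _ in hP; set M := sup _ in hP.
have cvm : theta_slope d ds a @[a --> +oo] --> (- m)%:E.
  have bnd : \forall a \near +oo,
      ((- m)%:E <= theta_slope d ds a <= (h * a^-1 - m)%:E)%E.
    near=> a; have [+ _] := hP a; apply.
    by near: a; exact: nbhs_pinfty_gt.
  apply: (squeeze_cvge bnd (cvg_cst _)).
  apply: cvg_EFin; first exact: nearW.
  rewrite -[X in _ --> X]add0r -[X in _ --> X + _](mulr0 h).
  exact: cvgD (cvgM (cvg_cst h) cvg_inv_pinfty) (cvg_cst _).
have cvM : theta_slope d ds a @[a --> -oo] --> (- M)%:E.
  have bnd : \forall a \near -oo,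
      ((h * a^-1 - M)%:E <= theta_slope d ds a <= (- M)%:E)%E.
    near=> a; have [_ +] := hP a; apply.
    by near: a; exact: nbhs_ninfty_lt.
  apply: (squeeze_cvge bnd _ (cvg_cst _)).
  apply: cvg_EFin; first exact: nearW.
  rewrite -[X in _ --> X]add0r -[X in _ --> X + _](mulr0 h).
  exact: cvgD (cvgM (cvg_cst h) cvg_inv_ninfty) (cvg_cst _).
have r0 := ratios_nonempty ds hd namen.
split; [by exists (- m)|by exists (- M)| |].
- rewrite /Dil_minus class_ratios// ereal_inf_EFin//; last first.
    by exists 0; exact: ratios_lbound.
  by rewrite /alpha_min (cvg_lim _ cvm)//= opprK.
- rewrite /Dil_plus class_ratios// ereal_sup_EFin//; last first.
    exact: ratios_has_ubound.
  by rewrite /alpha_max (cvg_lim _ cvM)//= opprK.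
Unshelve. all: by end_near. Qed.
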